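(* Use the day-ahead/real-time market model, the worst-case real-time consumer exposure $\hat V(\mathbf y)$, and the notation of the context. Let $\mathbf y^*$ be a feasible commitment vector (the commitment decisions in the current master problem solution). Let $\boldsymbol\omega^*=(d^{\mathrm{RT}*},p^{\max,\mathrm{RT}*})\in\Omega$, together with the corresponding LMPs $\lambda_{i\tau}(\mathbf y^*,\boldsymbol\omega^* )$, attain the worst-case real-time consumer exposure $\hat V^*(\mathbf y^* ):=\hat V(\mathbf y^* )$. For each hour $t\in\mathcal T^{\mathrm{RT|Hour}}$ set $$\mathcal I_{0t}=\{g\in\mathcal G^{\mathrm{Ther}}: y^*_{gt}=0\},$$ $$\hat V^*_t(\mathbf y^* )=\frac1{N^{\mathrm{tp}}}\sum_{\tau\in\mathcal T^{\mathrm{RT}}(t)}\sum_{i\in\mathcal N}\lambda_{i\tau}(\mathbf y^*,\boldsymbol\omega^* )\,(d^{\mathrm{RT}*}_{i\tau}-\bar D_{i\tau})^+ .$$ Suppose that there is no congestion in the network and that the ramping constraints are not binding in the real-time market. Then the logic-based Benders (LBBD) cut $$\hat V(\mathbf y)\ \ge\ \sum_{t\in\mathcal T^{\mathrm{RT|Hour}}}\hat V^*_t(\mathbf y^* )\Bigl(1-\sum_{g\in\mathcal I_{0t}}y_{gt}\Bigr)$$ provides a correct lower bound for $\hat V(\mathbf y)$, i.e. the inequality holds for every feasible commitment vector $\mathbf y$. Moreover, at $\mathbf y=\mathbf y^*$ the right-hand side equals the exact value $\hat V(\mathbf y^* )$.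
   Context: **Sets.** $\mathcal N$ is the set of buses. $\mathcal L$ is the set of directed transmission lines $(i,j)$. $\mathcal G=\mathcal G^{\mathrm{Ther}}\cup\mathcal G^{\mathrm{Wind}}$ is the set of thermal and wind generators, and $\mathcal G_i$ is the set of generators at bus $i$. $\mathcal O$ indexes the pieces of the piecewise linear production costs. $\mathcal T^{\mathrm{DA}}$ is the set of day-ahead hours. $\mathcal T^{\mathrm{RT}}$ is a set of real-time periods (possibly finer than an hour). $\mathcal T^{\mathrm{RT|Hour}}$ is the set of hours contained in $\mathcal T^{\mathrm{RT}}$. $\mathcal T^{\mathrm{RT}}(t)$ is the set of real-time periods in hour $t$. $N^{\mathrm{tp}}=|\mathcal T^{\mathrm{RT}}|/|\mathcal T^{\mathrm{RT|Hour}}|$. Write $(x)^+=\max\{x,0\}$. Hourly quantities such as $y_{gt}$, indexed by a real-time period, take the value of the hour containing it. **Feasible commitments (day-ahead master problem).** A commitment vector $\mathbf y=(y_{gt})\in\{0,1\}^{\mathcal G^{\mathrm{Ther}}\times\mathcal T^{\mathrm{DA}}}$ is feasible if there exist binary $v_{gt},w_{gt}$ (startup/shutdown) and real $p_{gt},h_{gt},p^{\mathrm{Unmet}}_{it},p^{\mathrm{Curtail}}_{gt},f_{ijt},\theta_{it}$ satisfying the following. - (cost) $h_{gt}\ge C^1_{og}p_{gt}+C^0_{og}y_{gt}$ for $o\in\mathcal O$, $g\in\mathcal G^{\mathrm{Ther}}$. - (load) $\sum_{g\in\mathcal G_i}p_{gt}+p^{\mathrm{Unmet}}_{it}+\sum_{(j,i)\in\mathcal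 L}f_{jit}-\sum_{(i,j)\in\mathcal L}f_{ijt}=\bar D_{it}$ and $p^{\mathrm{Unmet}}_{it}\ge0$, where $\bar D_{it}$ is the day-ahead expected load. - (flow) $f_{ijt}=B_{ij}(\theta_{it}-\theta_{jt})$ and $-P^{\mathrm{Trans}}_{ij}\le f_{ijt}\le P^{\mathrm{Trans}}_{ij}$. - (on/off) $v_{gt}-w_{gt}=y_{gt}-y_{g,t-1}$ for $t\neq1$. - (production) $P^{\min}_g y_{gt}\le p_{gt}\le P^{\max}_g y_{gt}$ for thermal $g$; $p_{gt}+p^{\mathrm{Curtail}}_{gt}=\bar P^{\max}_{gt}$ and $p^{\mathrm{Curtail}}_{gt}\ge0$ for wind $g$, where $\bar P^{\max}_{gt}$ is the forecast wind output; $p_{gt}\ge0$ for all $g$. - (ramping, $t\ne1$, thermal $g$) $p_{gt}-p_{g,t-1}\le M_gy_{g,t-1}+P^{\min}_gv_{gt}$ and $p_{g,t-1}-p_{gt}\le M_gy_{gt}+P^{\min}_gw_{gt}$. **Uncertainty set $\Omega$.** $\Omega$ is the set of all $\boldsymbol\omega=(d^{\mathrm{RT}}_{it},p^{\max,\mathrm{RT}}_{gt})$ ($i\in\mathcal N$, $g\in\mathcal G^{\mathrm{Wind}}$, $t\in\mathcal T^{\mathrm{RT}}$) for which there exist real stressors $\alpha^d_{kt},\alpha^w_{kt}$, $k=1,\dots,K$, with - $d^{\mathrm{RT}}_{it}=\bar D_{it}+\sum_kQ^d_{kit}\alpha^d_{kt}\ge0$, - $p^{\max,\mathrm{RT}}_{gt}=\bar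 P^{\max}_{gt}+\sum_kQ^w_{kgt}\alpha^w_{kt}\ge0$, - $|\sum_k\alpha^{ind}_{kt}|\le\Sigma^{ind}$ and $|\alpha^{ind}_{kt}|\le R^{ind}$ for $ind\in\{d,w\}$. Here $(Q^d_{kit})_i$ and $(Q^w_{kgt})_g$ are the normalized eigenvectors for the $K$ largest eigenvalues of given load and wind covariance matrices at time $t$, and $\Sigma^{ind},R^{ind}$ are given bounds. **Real-time problem $\mathrm{DCOPF}(\mathbf y,\boldsymbol\omega)$.** For fixed $\mathbf y$ and $\boldsymbol\omega$, minimize $\sum_{t\in\mathcal T^{\mathrm{RT}}}\bigl(\sum_{g\in\mathcal G}h_{gt}+\sum_{i\in\mathcal N}C^{\mathrm{VOLL|RT}}p^{\mathrm{Unmet}}_{it}\bigr)$ over (real-time) $h,p,p^{\mathrm{Unmet}},p^{\mathrm{Curtail}},f,\theta$. The constraints, for all $t\in\mathcal T^{\mathrm{RT}}$, are the cost, load, flow and production constraints above with $\mathbf y$ fixed, with $\bar D_{it}$ replaced by $d^{\mathrm{RT}}_{it}$ and $\bar P^{\max}_{gt}$ replaced by $p^{\max,\mathrm{RT}}_{gt}$, together with the real-time ramping constraints $|p_{gt}-p_{g,t-1}|\le\hat M_g$ for thermal $g$. Here $\hat M_g=M^{\mathrm{RT}}_g$ (the prorated ramping limit) if $y_{g,t-1}=y_{gt}=1$, and $\hat M_g=P^{\min}_g$ otherwise. $C^{\mathrm{VOLL|RT}}$ is the real-time value of lost load. The real-time locational marginal price (LMP) $\lambda_{it}(\mathbf y,\boldsymbol\omega)$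 is the optimal dual value of the load constraint at bus $i$ and period $t$ (marginal cost of load); it is understood that the real-time problems considered have optimal solutions. **Worst-case real-time consumer exposure.** $$\hat V(\mathbf y)=\max_{\boldsymbol\omega\in\Omega}\ \frac1{N^{\mathrm{tp}}}\sum_{t\in\mathcal T^{\mathrm{RT}}}\sum_{i\in\mathcal N}\lambda_{it}(\mathbf y,\boldsymbol\omega)\,(d^{\mathrm{RT}}_{it}-\bar D_{it})^+,$$ where $\lambda(\mathbf y,\boldsymbol\omega)$ ranges over optimal solutions of the dual of $\mathrm{DCOPF}(\mathbf y,\boldsymbol\omega)$ (the maximum is also over this choice if the dual optimum is not unique). The real-time consumer exposure $\lambda_{it}(\mathbf y,\boldsymbol\omega)(d^{\mathrm{RT}}_{it}-\bar D_{it})^+$ is a nonnegative payment. **Terminology.** ''No congestion in the network'' means that the line flow limits are not binding in the real-time problems, so the real-time LMPs at all buses coincide in each period. ''Ramping constraints not binding in the real-time market'' means that the real-time ramping constraints $|p_{gt}-p_{g,t-1}|\le\hat M_g$ are not binding. Both are understood for the real-time problems $\mathrm{DCOPF}(\mathbf y,\boldsymbol\omega)$ under consideration (feasible $\mathbf y$, $\boldsymbol\omega\in\Omega$). *)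

(* Defs.v *)
From HB Require Import structures.
From mathcomp Require Import all_boot all_order all_algebra.
From mathcomp Require Import classical_sets reals.

Set Implicit Arguments.
Unset Strict Implicit.
Unset Printing Implicit Defensive.

Import Order.TTheory GRing.Theory Num.Theory.
Local Open Scope ring_scope.

(* Covariance matrices are the symmetric positive semidefinite ones. *)
Definition isCovariance (R : realType) (n : nat) (C : 'M[R]_n) : Prop :=
  C^T = C /\ forall u : 'rV[R]_n, 0 <= (u *m C *m u^T) 0 0.

(* Q k, k < K, are the first K members of an orthonormal eigenbasis of C (the
   rows of U) ordered by nonincreasing eigenvalue, ties being arbitrary. *)
Definition topEigenvectors (R : realType) (n K : nat) (C : 'M[R]_n)
    (Q : 'I_K -> 'I_n -> R) : Prop :=
  exists (U : 'M[R]_n) (e : 'rV[R]_n) (leKn : (K <= n)%N),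
    [/\ U *m U^T = 1%:M,
        U *m C = diag_mx e *m U,
        (forall i j : 'I_n, (i <= j)%N -> e 0 j <= e 0 i)
      & (forall k i, Q k i = U (widen_ord leKn k) i)].

(* Buses, thermal units, wind units, cost pieces, day-ahead hours and real-time
   periods are numbered from 0, so the first hour or period is 0.  The set of
   all generators is the disjoint union 'I_nther + 'I_nwind. *)
Record market (R : realType) := Market {
  nbus : nat;
  nther : nat;
  nwind : nat;
  npiece : nat;
  nhour : nat;
  nper : nat;
  nstress : nat;
  lines : {set 'I_nbus * 'I_nbus};
  busOf : 'I_nther + 'I_nwind -> 'I_nbus;
  hourOf : 'I_nper -> 'I_nhour;
  hourOf_homo : forall s t : 'I_nper, (s <= t)%N -> (hourOf s <= hourOf t)%N;
  slope : 'I_npiece -> 'I_nther -> R;      (* C^1_og *)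
  intercept : 'I_npiece -> 'I_nther -> R;  (* C^0_og *)
  suscept : 'I_nbus -> 'I_nbus -> R;       (* B_ij *)
  lineCap : 'I_nbus -> 'I_nbus -> R;       (* P^Trans_ij *)
  Pmin : 'I_nther -> R;
  Pmax : 'I_nther -> R;
  rampDA : 'I_nther -> R;                  (* M_g *)
  rampRT : 'I_nther -> R;                  (* M^RT_g *)
  voll : R;                                (* C^{VOLL|RT} *)
  loadDA : 'I_nbus -> 'I_nhour -> R;       (* \bar D_it *)
  windDA : 'I_nwind -> 'I_nhour -> R;      (* \bar P^max_gt *)
  covd : 'I_nper -> 'M[R]_nbus;
  covw : 'I_nper -> 'M[R]_nwind;
  covd_cov : forall t, isCovariance (covd t);
  covw_cov : forall t, isCovariance (covw t);
  Qd : 'I_nstress -> 'I_nbus -> 'I_nper -> R;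
  Qw : 'I_nstress -> 'I_nwind -> 'I_nper -> R;
  Qd_eigen : forall t, topEigenvectors (covd t) (fun k i => Qd k i t);
  Qw_eigen : forall t, topEigenvectors (covw t) (fun k g => Qw k g t);
  sumBoundD : R;                           (* Sigma^d *)
  sumBoundW : R;                           (* Sigma^w *)
  absBoundD : R;                           (* R^d *)
  absBoundW : R                            (* R^w *)
}.

Definition bus (R : realType) (S : market R) := 'I_(nbus S).
Definition ther (R : realType) (S : market R) := 'I_(nther S).
Definition wind (R : realType) (S : market R) := 'I_(nwind S).
Definition gen (R : realType) (S : market R) :=
  ('I_(nther S) + 'I_(nwind S))%type.
Definition piece (R : realType) (S : market R) := 'I_(npiece S).
Definition hour (R : realType) (S : market R) := 'I_(nhour S).
Definition period (R : realType) (S : market R) := 'I_(nper S).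

Definition commitment (R : realType) (S : market R) := ther S -> hour S -> bool.

(* Decision variables of a dispatch over the time index set T.  Only thermal
   units carry a cost variable: wind production is free.  Entries of flow at
   pairs outside lines S occur in no constraint. *)
Record dispatch (R : realType) (S : market R) (T : Type) := Dispatch {
  gcost : ther S -> T -> R;                (* h_gt *)
  prod : gen S -> T -> R;                  (* p_gt *)
  unmet : bus S -> T -> R;
  curtail : wind S -> T -> R;
  flow : bus S -> bus S -> T -> R;
  angle : bus S -> T -> R
}.

Section Dispatch.
Variables (R : realType) (S : market R) (T : Type).
Variables (y : ther S -> T -> bool).
Variables (D : bus S -> T -> R) (W : wind S -> T -> R).

Definition supply (x : dispatch S T) (i : bus S) (t : T) : R :=
  \sum_(g : gen S | busOf g == i) prod x g t + unmet x i t
  + \sum_(j : bus S | (j, i) \in lines S) flow x j i t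
  - \sum_(j : bus S | (i, j) \in lines S) flow x i j t.

(* The constraints common to the day-ahead and the real-time problems. *)
Record dispatchOK (x : dispatch S T) : Prop := DispatchOK {
  ok_cost : forall o g t,
    slope o g * prod x (inl g) t + intercept o g * (y g t)%:R <= gcost x g t;
  ok_load : forall i t, supply x i t = D i t;
  ok_unmet : forall i t, 0 <= unmet x i t;
  ok_flow : forall i j t, (i, j) \in lines S ->
    flow x i j t = suscept i j * (angle x i t - angle x j t);
  ok_limit : forall i j t, (i, j) \in lines S ->
    - lineCap i j <= flow x i j t <= lineCap i j;
  ok_ther : forall g t,
    Pmin g * (y g t)%:R <= prod x (inl g) t <= Pmax g * (y g t)%:R;
  ok_wind : forall g t, prod x (inr g) t + curtail x g t = W g t;
  ok_curtail : forall g t, 0 <= curtail x g t;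
  ok_prod : forall g t, 0 <= prod x g t
}.

End Dispatch.

Record dayAheadOK (R : realType) (S : market R) (y v w : commitment S)
    (x : dispatch S (hour S)) : Prop := DayAheadOK {
  da_dispatch : dispatchOK y (@loadDA R S) (@windDA R S) x;
  da_onoff : forall g (s t : hour S), t = s.+1 :> nat ->
    (v g t)%:R - (w g t)%:R = (y g t)%:R - (y g s)%:R :> R;
  da_rampup : forall g (s t : hour S), t = s.+1 :> nat ->
    prod x (inl g) t - prod x (inl g) s
      <= rampDA g * (y g s)%:R + Pmin g * (v g t)%:R;
  da_rampdown : forall g (s t : hour S), t = s.+1 :> nat ->
    prod x (inl g) s - prod x (inl g) t
      <= rampDA g * (y g t)%:R + Pmin g * (w g t)%:R
}.

Definition feasible (R : realType) (S : market R) (y : commitment S) : Prop :=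
  exists (v w : commitment S) (x : dispatch S (hour S)), dayAheadOK y v w x.

Record scenario (R : realType) (S : market R) := Scenario {
  loadRT : bus S -> period S -> R;
  windRT : wind S -> period S -> R
}.

Definition Omega (R : realType) (S : market R) (om : scenario S) : Prop :=
  exists alphad alphaw : 'I_(nstress S) -> period S -> R,
    [/\ (forall i t, loadRT om i t
           = loadDA i (hourOf t) + \sum_k Qd k i t * alphad k t),
        (forall i t, 0 <= loadRT om i t),
        (forall g t, windRT om g t
           = windDA g (hourOf t) + \sum_k Qw k g t * alphaw k t)
      & (forall g t, 0 <= windRT om g t)] /\
    [/\ (forall t, `|\sum_k alphad k t| <= sumBoundD S),
        (forall k t, `|alphad k t| <= absBoundD S),
        (forall t, `|\sum_k alphaw k t| <= sumBoundW S)
      & (forall k t, `|alphaw k t| <= absBoundW S)].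

Section RealTime.
Variables (R : realType) (S : market R).
Implicit Types (y : commitment S) (om : scenario S).

Definition rampLimit y (g : ther S) (s t : period S) : R :=
  if y g (hourOf s) && y g (hourOf t) then rampRT g else Pmin g.

Definition rtOK y om (x : dispatch S (period S)) : Prop :=
  dispatchOK (fun g t => y g (hourOf t)) (loadRT om) (windRT om) x /\
  forall g (s t : period S), t = s.+1 :> nat ->
    `|prod x (inl g) t - prod x (inl g) s| <= rampLimit y g s t.

Definition rtCost (x : dispatch S (period S)) : R :=
  \sum_(t : period S) (\sum_g gcost x g t + \sum_i voll S * unmet x i t).

Definition rtOptimal y om (x : dispatch S (period S)) : Prop :=
  rtOK y om x /\ forall x', rtOK y om x' -> rtCost x <= rtCost x'.

(* Dual variables of DCOPF, one per constraint (two for |.| <= .); those of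
   the equalities (m_load, m_flow, m_wind) are free, the others nonnegative. *)
Record multipliers := Multipliers {
  m_load : bus S -> period S -> R;
  m_unmet : bus S -> period S -> R;
  m_cost : piece S -> ther S -> period S -> R;
  m_pmin : ther S -> period S -> R;
  m_pmax : ther S -> period S -> R;
  m_wind : wind S -> period S -> R;
  m_curtail : wind S -> period S -> R;
  m_prod : gen S -> period S -> R;
  m_flow : bus S -> bus S -> period S -> R;
  m_limitup : bus S -> bus S -> period S -> R;
  m_limitdown : bus S -> bus S -> period S -> R;
  m_rampup : ther S -> period S -> R;
  m_rampdown : ther S -> period S -> R
}.

Record dualSigns (mu : multipliers) : Prop := DualSigns {
  sign_unmet : forall i t, 0 <= m_unmet mu i t;
  sign_cost : forall o g t, 0 <= m_cost mu o g t;
  sign_pmin : forall g t, 0 <= m_pmin mu g t;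
  sign_pmax : forall g t, 0 <= m_pmax mu g t;
  sign_curtail : forall g t, 0 <= m_curtail mu g t;
  sign_prod : forall g t, 0 <= m_prod mu g t;
  sign_limitup : forall i j t, 0 <= m_limitup mu i j t;
  sign_limitdown : forall i j t, 0 <= m_limitdown mu i j t;
  sign_rampup : forall g t, 0 <= m_rampup mu g t;
  sign_rampdown : forall g t, 0 <= m_rampdown mu g t
}.

(* Objective plus multiplier times violation, summed over all constraints.
   The load term m_load * (demand - supply) makes m_load the marginal cost of
   load, i.e. the derivative of the optimal cost in the demand. *)
Definition lagrangian y om (x : dispatch S (period S)) (mu : multipliers) : R :=
  rtCost x
  + \sum_(t : period S) \sum_i m_load mu i t * (loadRT om i t - supply x i t)
  + \sum_(t : period S) \sum_i m_unmet mu i t * (- unmet x i t)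
  + \sum_(t : period S) \sum_g \sum_o m_cost mu o g t *
      (slope o g * prod x (inl g) t + intercept o g * (y g (hourOf t))%:R
       - gcost x g t)
  + \sum_(t : period S) \sum_g m_pmin mu g t *
      (Pmin g * (y g (hourOf t))%:R - prod x (inl g) t)
  + \sum_(t : period S) \sum_g m_pmax mu g t *
      (prod x (inl g) t - Pmax g * (y g (hourOf t))%:R)
  + \sum_(t : period S) \sum_g m_wind mu g t *
      (windRT om g t - (prod x (inr g) t + curtail x g t))
  + \sum_(t : period S) \sum_g m_curtail mu g t * (- curtail x g t)
  + \sum_(t : period S) \sum_g m_prod mu g t * (- prod x g t)
  + \sum_(t : period S) \sum_(ij in lines S) m_flow mu ij.1 ij.2 t *
      (suscept ij.1 ij.2 * (angle x ij.1 t - angle x ij.2 t)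
       - flow x ij.1 ij.2 t)
  + \sum_(t : period S) \sum_(ij in lines S) m_limitup mu ij.1 ij.2 t *
      (flow x ij.1 ij.2 t - lineCap ij.1 ij.2)
  + \sum_(t : period S) \sum_(ij in lines S) m_limitdown mu ij.1 ij.2 t *
      (- lineCap ij.1 ij.2 - flow x ij.1 ij.2 t)
  + \sum_(t : period S) \sum_(s : period S | t == s.+1 :> nat) \sum_g
      m_rampup mu g t *
      (prod x (inl g) t - prod x (inl g) s - rampLimit y g s t)
  + \sum_(t : period S) \sum_(s : period S | t == s.+1 :> nat) \sum_g
      m_rampdown mu g t *
      (prod x (inl g) s - prod x (inl g) t - rampLimit y g s t).

(* (mu, v) is feasible for the linear programming dual, written as "maximize v
   subject to v <= lagrangian at every x".  The lagrangian being affine in x,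
   this holds iff its x-coefficients vanish and v is at most its constant term,
   the dual objective. *)
Definition dualFeasible y om (mu : multipliers) (v : R) : Prop :=
  dualSigns mu /\ forall x, v <= lagrangian y om x mu.

Definition dualOptimal y om (mu : multipliers) : Prop :=
  exists v : R, dualFeasible y om mu v /\
    forall mu' v', dualFeasible y om mu' v' -> v' <= v.

Definition isLMP y om (lam : bus S -> period S -> R) : Prop :=
  exists mu, dualOptimal y om mu /\ m_load mu = lam.

Definition rtHours : {set hour S} := [set hourOf t | t : period S]%SET.

Definition Ntp : R := (nper S)%:R / #|rtHours|%:R.

Definition loadExcess om (i : bus S) (t : period S) : R :=
  Num.max (loadRT om i t - loadDA i (hourOf t)) 0.

Definition exposure om (lam : bus S -> period S -> R) : R :=
  Ntp^-1 * \sum_(t : period S) \sum_i lam i t * loadExcess om i t.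

Definition hourExposure om (lam : bus S -> period S -> R) (h : hour S) : R :=
  Ntp^-1 * \sum_(t : period S | hourOf t == h)
    \sum_i lam i t * loadExcess om i t.

(* The maximum over omega in Omega and all optimal duals, as a supremum: the
   unmet-load column of the dual forces lam <= voll, so the values are bounded. *)
Definition Vhat y : R :=
  sup [set V : R | exists om lam,
    [/\ Omega om, isLMP y om lam & V = exposure om lam]]%classic.

Definition cut (ystar : commitment S) (omstar : scenario S)
    (lamstar : bus S -> period S -> R) y : R :=
  \sum_(t in rtHours) hourExposure omstar lamstar t *
    (1 - \sum_(g | ~~ ystar g t) (y g t)%:R).

End RealTime.

Section Assumptions.
Variables (R : realType) (S : market R).

Definition realTimeSolvable : Prop :=
  forall (y : commitment S) (om : scenario S), feasible y -> Omega om ->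
    exists x, rtOptimal y om x.

Definition exposureNonneg : Prop :=
  forall (y : commitment S) (om : scenario S), feasible y -> Omega om ->
    forall lam, isLMP y om lam -> forall i t, 0 <= lam i t * loadExcess om i t.

(* A family of constraints is "not binding" when its shadow prices can be taken
   to be 0 without changing the locational marginal prices.  By complementary
   slackness this holds whenever some optimal dispatch satisfies the family
   strictly.  Strictness itself is not required: the ramping constraint of a
   unit starting up (limit Pmin, production at least Pmin) holds with equality at
   every feasible dispatch, even when it can be dropped. *)

(* The uniform price is part of the notion: it does not follow from slack line
   limits alone unless the network is connected. *)
Definition noCongestion : Prop :=
  forall (y : commitment S) (om : scenario S), feasible y -> Omega om ->
    (forall mu, dualOptimal y om mu ->
       exists mu', [/\ dualOptimal y om mu', m_load mu' = m_load mu
         & forall i j t, (i, j) \in lines S ->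
             m_limitup mu' i j t = 0 /\ m_limitdown mu' i j t = 0]) /\
    (forall lam, isLMP y om lam -> forall i j t, lam i t = lam j t).

Definition rampingNotBinding : Prop :=
  forall (y : commitment S) (om : scenario S), feasible y -> Omega om ->
    forall mu, dualOptimal y om mu ->
      exists mu', [/\ dualOptimal y om mu', m_load mu' = m_load mu
        & forall g t, m_rampup mu' g t = 0 /\ m_rampdown mu' g t = 0].

End Assumptions.

(* Main.v *)
Require Import Defs.
From HB Require Import structures.
From mathcomp Require Import all_boot all_order all_algebra.
From mathcomp Require Import classical_sets reals.
From mathcomp Require Import boolp ring lra.

Import Order.TTheory GRing.Theory Num.Theory.
Local Open Scope ring_scope.

Set Implicit Arguments.
Unset Strict Implicit.

(** The cut holds because switching units off cannot lower real-time prices.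
    Fix the worst-case scenario of [ystar] and a feasible [y].  In an hour where
    [y] runs a unit that [ystar] does not, the factor of the hourly exposure is
    at most 0, and exposures are nonnegative.  In every other hour the units on
    in [y] are on in [ystar], the factor is 1, and it is enough to find prices
    for [y] that dominate those of [ystar] in all these hours at once
    ([exists_higher_LMP]).

    The comparison of prices is an exchange argument between dual solutions.
    Let [mu] be optimal for [ystar] and [nu] for [y], both with ramping
    multipliers 0, so that the lagrangian splits into a sum over periods
    ([lagrangian_separates]).  At the periods of such hours where [nu] has the
    lower price, interchange the multipliers of [mu] and [nu]; for a unit that is
    on in [ystar] and off in [y], keep those of [mu] on both sides and absorb the
    fall of the price into the multiplier of [0 <= prod].  The constraint
    [0 <= prod] is where the direction of the monotonicity comes from: that
    multiplier can only be increased.  The exchange preserves the sum of the two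
    dual values ([lagrangian_exchange]); as the new multipliers for [ystar]
    cannot beat [mu], the new ones for [y] are as good as [nu], hence optimal
    ([raised_dualOptimal]).  Absence of congestion enters through the uniformity
    of prices, which makes the choice of periods the same at all buses.

    Two facts are needed around this.  An optimal dual solution for [y] must
    exist, which is linear programming duality ([dualOptimal_exists]), derived
    from the Farkas lemma.  And [Vhat y], a supremum, must bound each exposure,
    which holds because prices are at most the value of lost load and the load
    excess is bounded on the uncertainty set ([exposure_le_Vhat]). *)

(** * The Farkas lemma and Lagrange multipliers *)

Section Farkas.
Variables (R : realFieldType) (X : Type) (shift : X -> R -> X -> X).

(** Here [shift x a z] stands for [x + a z]: the proof only combines vectors in
    this way, so no axiom of vector spaces has to be established for [X]. *)
Definition linearOn (f : X -> R) : Prop :=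
  forall x a z, f (shift x a z) = f x + a * f z.

(** Induction on the constraints, after Bartl.  If the constraint [f k0] cannot
    be dropped, some [x0] satisfies the others while [c x0 > 0], hence
    [f k0 x0 > 0]; projecting along [x0] onto the kernel of [f k0] leaves a
    problem with one constraint less. *)
Lemma farkas (K : eqType) (r : seq K) (f : K -> X -> R) (c : X -> R) :
    uniq r -> (forall k, linearOn (f k)) -> linearOn c ->
    (forall x, (forall k, k \in r -> f k x <= 0) -> c x <= 0) ->
  exists m : K -> R, (forall k, 0 <= m k) /\
    forall x, c x = \sum_(k <- r) m k * f k x.
Proof.
elim: r f c => [|k0 r IHr] f c /=.
  move=> _ _ lin_c c_le0; exists (fun=> 0); split=> // x.
  have c_le (z : X) : c z <= 0 by apply: c_le0.
  have := c_le (shift x (- 2%:R) x); rewrite big_nil lin_c.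
  by have := c_le x; lra.
move=> /andP[k0r uniq_r] lin_f lin_c c_le0.
have [[x0 [x0_r c_x0]]|no_x0] := pselect (exists x0,
    (forall k, k \in r -> f k x0 <= 0) /\ 0 < c x0); last first.
  have [|m [m_ge0 cE]] := IHr f c uniq_r lin_f lin_c.
    by move=> x x_r; rewrite leNgt; apply/negP => c_x; apply: no_x0; exists x.
  exists (fun k => if k == k0 then 0 else m k); split.
    by move=> k; case: eqP.
  move=> x; rewrite big_cons eqxx mul0r add0r cE.
  apply: eq_big_seq => k kr; case: eqP => // kk0.
  by rewrite -kk0 kr in k0r.
have f0_x0 : 0 < f k0 x0.
  rewrite ltNge; apply/negP => f0_le0.
  suff: c x0 <= 0 by rewrite leNgt c_x0.
  by apply: c_le0 => k; rewrite in_cons => /predU1P[->|/x0_r].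
have f0_neq0 : f k0 x0 != 0 by rewrite gt_eqF.
(* proj h x is the value of h at the projection of x. *)
pose proj (h : X -> R) x := h x - h x0 / f k0 x0 * f k0 x.
have projE h x : linearOn h -> proj h x = h (shift x (- (f k0 x / f k0 x0)) x0).
  by move=> lin_h; rewrite lin_h /proj; field.
have lin_proj h : linearOn h -> linearOn (proj h).
  by move=> lin_h x a z; rewrite /proj !lin_h lin_f; ring.
have [|||m [m_ge0 cE]] := IHr (fun k => proj (f k)) (proj c) uniq_r.
- by move=> k; apply: lin_proj.
- exact: lin_proj.
- move=> x x_r; rewrite projE//; apply: c_le0 => k.
  rewrite in_cons => /predU1P[->|kr]; last by rewrite -projE// x_r.
  by rewrite -projE// /proj divff// mul1r subrr.
(* The value at x0 dictates the multiplier of the remaining constraint. *)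
pose m0 := (c x0 - \sum_(k <- r) m k * f k x0) / f k0 x0.
exists (fun k => if k == k0 then m0 else m k); split.
  move=> k; case: eqP => // _; rewrite divr_ge0 ?(ltW f0_x0)// subr_ge0.
  apply: le_trans (ltW c_x0); rewrite big_seq sumr_le0// => j jr.
  by rewrite mulr_ge0_le0 ?x0_r.
move=> x; rewrite big_cons eqxx.
rewrite (_ : \sum_(k <- r) _ = \sum_(k <- r) m k * f k x); last first.
  apply: eq_big_seq => k kr; case: eqP => // kk0.
  by rewrite -kk0 kr in k0r.
have := cE x; rewrite {1}/proj.
rewrite (_ : \sum_(k <- r) _ = \sum_(k <- r) m k * f k x
    - (\sum_(k <- r) m k * f k x0) / f k0 x0 * f k0 x); last first.
  rewrite mulr_suml mulr_suml -sumrB; apply: eq_bigr => k _.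
  by rewrite /proj; ring.
move=> /eqP; rewrite subr_eq => /eqP ->; rewrite /m0; ring.
Qed.

End Farkas.

Section Lagrange.
Variables (R : realFieldType) (X : Type) (zero : X) (shift : X -> R -> X -> X).

Definition affineOn (f : X -> R) : Prop :=
  forall x a z, f (shift x a z) = f x + a * (f z - f zero).

Definition satisfies (K : Type) (free : pred K) (f : K -> X -> R) x : Prop :=
  forall k, if free k then f k x = 0 else f k x <= 0.

(** The Farkas lemma in the homogenized space [X * R], whose points [(x, s)] with
    [s > 0] represent [x / s]; an equality counts as two opposite
    inequalities. *)
Lemma lagrange_multipliers_exist (K : finType) (free : pred K)
    (f : K -> X -> R) (c : X -> R) (x0 : X) :
    (forall k, affineOn (f k)) -> affineOn c -> satisfies free f x0 ->
    (forall x, satisfies free f x -> c x0 <= c x) ->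
  exists m : K -> R, (forall k, ~~ free k -> 0 <= m k) /\
    forall x, c x0 <= c x + \sum_k m k * f k x.
Proof.
move=> aff_f aff_c x0_f x0_min.
pose hshift (u : X * R) a (w : X * R) := (shift u.1 a w.1, u.2 + a * w.2).
pose hom (h : X -> R) (u : X * R) := h u.1 - h zero + u.2 * h zero.
have lin_hom h : affineOn h -> linearOn hshift (hom h).
  by move=> aff_h u a w; rewrite /hom /= aff_h; ring.
(* The first summand carries the constraint s >= 0. *)
pose F (k : unit + (K + K)) (u : X * R) := match k with
  | inl _ => - u.2
  | inr (inl k) => hom (f k) u
  | inr (inr k) => - (free k)%:R * hom (f k) u end.
have lin_F k : linearOn hshift (F k).
  case: k => [_|[k|k]] u a w /=; first by ring.
  - exact: (lin_hom _ (aff_f k)).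
  - by rewrite (lin_hom _ (aff_f k)); ring.
have lin_c : linearOn hshift (fun u => u.2 * c x0 - hom c u).
  by move=> u a w; rewrite (lin_hom _ aff_c) /=; ring.
have [|m [m_ge0 cE]] := farkas (index_enum_uniq _) lin_F lin_c.
  move=> [x s] F_le0.
  have homx k : if free k then hom (f k) (x, s) = 0 else hom (f k) (x, s) <= 0.
    have := F_le0 (inr (inl k)) (mem_index_enum _).
    have := F_le0 (inr (inr k)) (mem_index_enum _).
    rewrite /F /=; case: ifP => _ //; rewrite mulN1r => h1 h2.
    by apply/eqP; rewrite eq_le h2 -oppr_le0.
  have /= s_ge0 := F_le0 (inl tt) (mem_index_enum _).
  rewrite oppr_le0 le_eqVlt in s_ge0.
  rewrite /hom /= in homx *.
  have /predU1P[s0|s_gt0] := s_ge0.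
    (* For s = 0, x is a direction of recession of the feasible set. *)
    have: c x0 <= c (shift x0 1 x).
      apply: x0_min => k; rewrite aff_f.
      by move: (x0_f k) (homx k); rewrite -s0; case: ifP => _; lra.
    by rewrite aff_c -s0; lra.
  (* For s > 0, the point x / s is feasible. *)
  have s_neq0 : s != 0 by rewrite gt_eqF.
  have shiftE h : affineOn h ->
      h (shift x (s^-1 - 1) x) = s^-1 * (h x - h zero + s * h zero).
    by move=> aff_h; rewrite aff_h; field.
  have: c x0 <= c (shift x (s^-1 - 1) x).
    apply: x0_min => k; rewrite shiftE//.
    move: (homx k); case: ifP => _ hk; first by rewrite hk mulr0.
    by rewrite mulr_ge0_le0// invr_ge0 ltW.
  by rewrite shiftE// -(ler_pM2l s_gt0) mulVKf//; lra.
exists (fun k => m (inr (inl k)) - m (inr (inr k)) * (free k)%:R); split.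
  by move=> k /negPf ->; rewrite mulr0 subr0.
move=> x; have := cE (x, 1).
rewrite !big_sumType (big_pred1 tt) /= ?mul1r; last by case.
rewrite /hom /= => cx.
have -> : \sum_k (m (inr (inl k)) - m (inr (inr k)) * (free k)%:R) * f k x =
    \sum_k m (inr (inl k)) * hom (f k) (x, 1) +
    \sum_k m (inr (inr k)) * (- (free k)%:R * hom (f k) (x, 1)).
  by rewrite -big_split /=; apply: eq_bigr => k _; rewrite /hom /=; ring.
move: cx; rewrite /hom /=.
by have := m_ge0 (inl tt); lra.
Qed.

End Lagrange.

(** * Duality for the real-time problem *)

Section DispatchSpace.
Variables (R : realType) (S : market R).
Local Notation plan := (dispatch S (period S)).

Definition zeroPlan : plan :=
  Dispatch (fun _ _ => 0) (fun _ _ => 0) (fun _ _ => 0) (fun _ _ => 0)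
    (fun _ _ _ => 0) (fun _ _ => 0).

Definition shiftPlan (x : plan) (a : R) (z : plan) : plan :=
  Dispatch (fun g t => gcost x g t + a * gcost z g t)
    (fun g t => prod x g t + a * prod z g t)
    (fun i t => unmet x i t + a * unmet z i t)
    (fun g t => curtail x g t + a * curtail z g t)
    (fun i j t => flow x i j t + a * flow z i j t)
    (fun i t => angle x i t + a * angle z i t).

Lemma supply_shift x a z i t :
  supply (shiftPlan x a z) i t = supply x i t + a * supply z i t.
Proof. by rewrite /supply /= !big_split /= -!mulr_sumr; ring. Qed.

Lemma supply_zero i t : supply zeroPlan i t = 0.
Proof. by rewrite /supply /= !big1_eq; ring. Qed.

Lemma rtCost_affine : affineOn zeroPlan shiftPlan (@rtCost R S).
Proof.
move=> x a z; rewrite /rtCost /= -sumrB mulr_sumr -big_split /=.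
apply: eq_bigr => t _; rewrite big1_eq big_split /= -mulr_sumr.
have -> : \sum_i voll S * (unmet x i t + a * unmet z i t) =
    \sum_i voll S * unmet x i t + a * \sum_i voll S * unmet z i t.
  by rewrite mulr_sumr -big_split /=; apply: eq_bigr => i _; ring.
have -> : \sum_(i < nbus S) voll S * 0 = 0 by rewrite -mulr_sumr big1_eq mulr0.
ring.
Qed.

(** The constraints of the real-time problem, in the order of the terms of the
    lagrangian.  A sum of products, rather than an inductive type, is a finite
    type at once, and sums over it split into the terms of the lagrangian. *)
Definition constraint : Type :=
  (((((((((((((period S * bus S) + (period S * bus S))
  + (period S * (ther S * piece S))) + (period S * ther S))
  + (period S * ther S)) + (period S * wind S)) + (period S * wind S))
  + (period S * gen S)) + (period S * (bus S * bus S)))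
  + (period S * (bus S * bus S))) + (period S * (bus S * bus S)))
  + (period S * ther S)) + (period S * ther S))%type.

Local Notation kLoad t i := (inl (inl (inl (inl (inl (inl
    (inl (inl (inl (inl (inl (inl (t, i))))))))))))).
Local Notation kUnmet t i := (inl (inl (inl (inl (inl (inl
    (inl (inl (inl (inl (inl (inr (t, i))))))))))))).
Local Notation kCost t g o := (inl (inl (inl (inl (inl (inl
    (inl (inl (inl (inl (inr (t, (g, o))))))))))))).
Local Notation kPmin t g := (inl (inl (inl (inl (inl (inl
    (inl (inl (inl (inr (t, g))))))))))).
Local Notation kPmax t g := (inl (inl (inl (inl (inl (inl
    (inl (inl (inr (t, g)))))))))).
Local Notation kWind t g := (inl (inl (inl (inl (inl (inl
    (inl (inr (t, g))))))))).
Local Notation kCurtail t g := (inl (inl (inl (inl (inl (inl (inr (t, g)))))))).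
Local Notation kProd t g := (inl (inl (inl (inl (inl (inr (t, g))))))).
Local Notation kFlow t ij := (inl (inl (inl (inl (inr (t, ij)))))).
Local Notation kLimitUp t ij := (inl (inl (inl (inr (t, ij))))).
Local Notation kLimitDown t ij := (inl (inl (inr (t, ij)))).
Local Notation kRampUp t g := (inl (inr (t, g))).
Local Notation kRampDown t g := (inr (t, g)).

(** The sum has one term, at the period before [t], or none if [t] is the first
    period; the ramping constraint there reads [0 <= 0]. *)
Definition afterPrevious (t : period S) (F : period S -> R) : R :=
  \sum_(s : period S | t == s.+1 :> nat) F s.

(** A constraint indexed by a pair of buses without a line reads [0 <= 0] or
    [0 = 0]. *)
Definition onLine (ij : bus S * bus S) (v : R) : R :=
  if ij \in lines S then v else 0.

Definition violation (y : commitment S) (om : scenario S) (k : constraint)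
    (x : plan) : R :=
  match k with
  | kLoad t i => loadRT om i t - supply x i t
  | kUnmet t i => - unmet x i t
  | kCost t g o =>
      slope o g * prod x (inl g) t + intercept o g * (y g (hourOf t))%:R
      - gcost x g t
  | kPmin t g => Pmin g * (y g (hourOf t))%:R - prod x (inl g) t
  | kPmax t g => prod x (inl g) t - Pmax g * (y g (hourOf t))%:R
  | kWind t g => windRT om g t - (prod x (inr g) t + curtail x g t)
  | kCurtail t g => - curtail x g t
  | kProd t g => - prod x g t
  | kFlow t ij => onLine ij
      (suscept ij.1 ij.2 * (angle x ij.1 t - angle x ij.2 t)
       - flow x ij.1 ij.2 t)
  | kLimitUp t ij => onLine ij (flow x ij.1 ij.2 t - lineCap ij.1 ij.2)
  | kLimitDown t ij => onLine ij (- lineCap ij.1 ij.2 - flow x ij.1 ij.2 t)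
  | kRampUp t g => afterPrevious t (fun s =>
      prod x (inl g) t - prod x (inl g) s - rampLimit y g s t)
  | kRampDown t g => afterPrevious t (fun s =>
      prod x (inl g) s - prod x (inl g) t - rampLimit y g s t)
  end.

Definition isEquality (k : constraint) : bool :=
  match k with
  | kLoad _ _ | kWind _ _ | kFlow _ _ => true
  | _ => false
  end.

Definition price (mu : multipliers S) (k : constraint) : R :=
  match k with
  | kLoad t i => m_load mu i t
  | kUnmet t i => m_unmet mu i t
  | kCost t g o => m_cost mu o g t
  | kPmin t g => m_pmin mu g t
  | kPmax t g => m_pmax mu g t
  | kWind t g => m_wind mu g t
  | kCurtail t g => m_curtail mu g t
  | kProd t g => m_prod mu g t
  | kFlow t ij => m_flow mu ij.1 ij.2 t
  | kLimitUp t ij => m_limitup mu ij.1 ij.2 t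
  | kLimitDown t ij => m_limitdown mu ij.1 ij.2 t
  | kRampUp t g => m_rampup mu g t
  | kRampDown t g => m_rampdown mu g t
  end.

Definition ofPrices (m : constraint -> R) : multipliers S :=
  Multipliers
    (fun i t => m (kLoad t i)) (fun i t => m (kUnmet t i))
    (fun o g t => m (kCost t g o))
    (fun g t => m (kPmin t g)) (fun g t => m (kPmax t g))
    (fun g t => m (kWind t g)) (fun g t => m (kCurtail t g))
    (fun g t => m (kProd t g))
    (fun i j t => m (kFlow t (i, j))) (fun i j t => m (kLimitUp t (i, j)))
    (fun i j t => m (kLimitDown t (i, j)))
    (fun g t => m (kRampUp t g)) (fun g t => m (kRampDown t g)).

Lemma constraintP (P : constraint -> Prop) :
    (forall t i, P (kLoad t i)) -> (forall t i, P (kUnmet t i)) ->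
    (forall t g o, P (kCost t g o)) ->
    (forall t g, P (kPmin t g)) -> (forall t g, P (kPmax t g)) ->
    (forall t g, P (kWind t g)) -> (forall t g, P (kCurtail t g)) ->
    (forall t g, P (kProd t g)) ->
    (forall t i j, P (kFlow t (i, j))) -> (forall t i j, P (kLimitUp t (i, j))) ->
    (forall t i j, P (kLimitDown t (i, j))) ->
    (forall t g, P (kRampUp t g)) -> (forall t g, P (kRampDown t g)) ->
  forall k, P k.
Proof.
by move=> ? ? ? ? ? ? ? ? ? ? ? ? ? [[[[[[[[[[[[[]|[]]|[? []]]|[]]|[]]|[]]|[]]|[]]|
  [? []]]|[? []]]|[? []]]|[]]|[]].
Qed.

Lemma ofPricesK m : price (ofPrices m) =1 m.
Proof. exact: constraintP. Qed.

Lemma dualSignsP mu :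
  dualSigns mu <-> forall k, ~~ isEquality k -> 0 <= price mu k.
Proof.
split=> [[? ? ? ? ? ? ? ? ? ?]|mu_ge0].
  by apply: constraintP => *; rewrite /=.
split.
- by move=> i t; apply: (mu_ge0 (kUnmet t i)).
- by move=> o g t; apply: (mu_ge0 (kCost t g o)).
- by move=> g t; apply: (mu_ge0 (kPmin t g)).
- by move=> g t; apply: (mu_ge0 (kPmax t g)).
- by move=> g t; apply: (mu_ge0 (kCurtail t g)).
- by move=> g t; apply: (mu_ge0 (kProd t g)).
- by move=> i j t; apply: (mu_ge0 (kLimitUp t (i, j))).
- by move=> i j t; apply: (mu_ge0 (kLimitDown t (i, j))).
- by move=> g t; apply: (mu_ge0 (kRampUp t g)).
- by move=> g t; apply: (mu_ge0 (kRampDown t g)).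
Qed.

Lemma lagrangianE y om x mu : lagrangian y om x mu =
  rtCost x + \sum_k price mu k * violation y om k x.
Proof.
have pairs (J : finType) (F : period S -> J -> R) :
    \sum_(p : period S * J) F p.1 p.2 = \sum_t \sum_j F t j.
  by rewrite pair_bigA.
have pairs3 (F : period S -> ther S -> piece S -> R) :
    \sum_(p : period S * (ther S * piece S)) F p.1 p.2.1 p.2.2 =
    \sum_t \sum_g \sum_o F t g o.
  by rewrite (pairs _ (fun t q => F t q.1 q.2)); apply: eq_bigr => t _;
     rewrite pair_bigA.
have lines_ (m F : period S -> bus S * bus S -> R) :
    \sum_t \sum_(ij in lines S) m t ij * F t ij =
    \sum_(p : period S * (bus S * bus S)) m p.1 p.2 * onLine p.2 (F p.1 p.2).
  rewrite (pairs _ (fun t ij => m t ij * onLine ij (F t ij))).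
  apply: eq_bigr => t _; rewrite big_mkcond; apply: eq_bigr => ij _.
  by rewrite /onLine; case: ifP; rewrite ?mulr0.
have ramp (m : ther S -> period S -> R)
    (F : period S -> period S -> ther S -> R) :
    \sum_(t : period S) \sum_(s : period S | t == s.+1 :> nat) \sum_g
      m g t * F t s g =
    \sum_(p : period S * ther S)
      m p.2 p.1 * afterPrevious p.1 (fun s => F p.1 s p.2).
  rewrite (pairs _ (fun t g => m g t * afterPrevious t (fun s => F t s g))).
  apply: eq_bigr => t _; rewrite exchange_big; apply: eq_bigr => g _ /=.
  by rewrite mulr_sumr.
rewrite /lagrangian !ramp !lines_ -pairs3 -!pairs !big_sumType /= -!addrA.
by do ![congr (_ + _)]; apply: eq_bigr => -[? //] => -[].
Qed.

Lemma afterPrevious_le0 (t : period S) (F : period S -> R) :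
  afterPrevious t F <= 0 <-> forall s : period S, t = s.+1 :> nat -> F s <= 0.
Proof.
split=> [F_le0 s ts|F_le0]; last by apply: sumr_le0 => s /eqP; apply: F_le0.
suff -> : F s = afterPrevious t F by [].
by rewrite /afterPrevious (big_pred1 s) // => r /=; rewrite ts eqSS eq_sym.
Qed.

Lemma violation_affine y om k : affineOn zeroPlan shiftPlan (violation y om k).
Proof.
move: k; apply: constraintP => * x a z;
  rewrite /violation ?supply_shift ?supply_zero /onLine /=.
all: try by [ring | case: ifP => _; ring].
all: rewrite /afterPrevious -sumrB mulr_sumr -big_split /=.
all: by apply: eq_bigr => s _; ring.
Qed.

Lemma satisfies_violationP y om x :
  satisfies isEquality (violation y om) x <-> rtOK y om x.
Proof.
split=> [ok|[[ok_c ok_l ok_u ok_f ok_lim ok_t ok_w ok_cu ok_p] ok_r]].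
  split; first split.
  - by move=> o g t; have := ok (kCost t g o); rewrite /= subr_le0.
  - by move=> i t; have /subr0_eq := ok (kLoad t i).
  - by move=> i t; have := ok (kUnmet t i); rewrite /= oppr_le0.
  - move=> i j t ij; have := ok (kFlow t (i, j)).
    by rewrite /= /onLine ij => /subr0_eq.
  - move=> i j t ij.
    have := ok (kLimitUp t (i, j)); have := ok (kLimitDown t (i, j)).
    by rewrite /= /onLine ij; lra.
  - by move=> g t; have := ok (kPmin t g); have := ok (kPmax t g) => /=; lra.
  - by move=> g t; have /subr0_eq := ok (kWind t g).
  - by move=> g t; have := ok (kCurtail t g); rewrite /= oppr_le0.
  - by move=> g t; have := ok (kProd t g); rewrite /= oppr_le0.
  move=> g s t ts; rewrite ler_norml.
  have /afterPrevious_le0/(_ s ts) := ok (kRampUp t g).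
  have /afterPrevious_le0/(_ s ts) := ok (kRampDown t g).
  by move=> ? ?; apply/andP; split; lra.
apply: constraintP => /=.
- by move=> t i; rewrite ok_l subrr.
- by move=> t i; rewrite oppr_le0.
- by move=> t g o; rewrite subr_le0.
- by move=> t g; have := ok_t g t; lra.
- by move=> t g; have := ok_t g t; lra.
- by move=> t g; rewrite ok_w subrr.
- by move=> t g; rewrite oppr_le0.
- by move=> t g; rewrite oppr_le0.
- by move=> t i j; rewrite /onLine; case: ifP => // /ok_f ->; rewrite subrr.
- by move=> t i j; rewrite /onLine; case: ifP => // /ok_lim-/(_ t) /=; lra.
- by move=> t i j; rewrite /onLine; case: ifP => // /ok_lim-/(_ t) /=; lra.
- move=> t g; apply/afterPrevious_le0 => s ts.
  by have := ok_r g s t ts; rewrite ler_norml; lra.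
- move=> t g; apply/afterPrevious_le0 => s ts.
  by have := ok_r g s t ts; rewrite ler_norml; lra.
Qed.

(** Strong duality: the Lagrange multipliers at an optimal dispatch certify a
    dual value equal to its cost, which no dual value exceeds. *)
Lemma dualOptimal_exists (y : commitment S) om x :
  rtOptimal y om x -> exists mu, dualOptimal y om mu.
Proof.
move=> [/satisfies_violationP x_ok x_min].
have [|m [m_ge0 m_x]] := lagrange_multipliers_exist
    (violation_affine y om) rtCost_affine x_ok.
  by move=> z /satisfies_violationP; apply: x_min.
exists (ofPrices m), (rtCost x); split.
  split=> [|z]; first by apply/dualSignsP => k; rewrite ofPricesK; apply: m_ge0.
  rewrite lagrangianE; under eq_bigr do rewrite ofPricesK.
  exact: m_x.
move=> mu v [/dualSignsP mu_ge0 /(_ x) v_le]; apply: (le_trans v_le).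
rewrite lagrangianE gerDl; apply: sumr_le0 => k _.
have := mu_ge0 k; have := x_ok k; case: isEquality => [-> _|? ?].
  by rewrite mulr0.
by rewrite mulr_ge0_le0 //; auto.
Qed.

End DispatchSpace.

(** * Separation of the lagrangian over periods *)

Section Separation.
Variables (R : realType) (S : market R).
Local Notation plan := (dispatch S (period S)).

(** Contribution of a unit to the lagrangian in one period, at the price [lam] of
    its bus; [on] is its commitment, [h] and [p] its cost and production, and
    [c], [a], [b], [r] are the multipliers of its cost pieces, of [Pmin], of
    [Pmax] and of [0 <= p]. *)
Definition thermalTerm (g : ther S) (on : bool) (lam : R) (c : piece S -> R)
    (a b r h p : R) : R :=
  h + \sum_o c o * (slope o g * p + intercept o g * on%:R - h)
  + a * (Pmin g * on%:R - p) + b * (p - Pmax g * on%:R) + r * (- p) - lam * p.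

Definition thermalPart (y : commitment S) (mu : multipliers S) (x : plan)
    (t : period S) (g : ther S) : R :=
  thermalTerm g (y g (hourOf t)) (m_load mu (busOf (inl g)) t)
    (fun o => m_cost mu o g t) (m_pmin mu g t) (m_pmax mu g t)
    (m_prod mu (inl g) t) (gcost x g t) (prod x (inl g) t).

Definition windPart (om : scenario S) (mu : multipliers S) (x : plan)
    (t : period S) (g : wind S) : R :=
  m_wind mu g t * (windRT om g t - (prod x (inr g) t + curtail x g t))
  + m_curtail mu g t * (- curtail x g t)
  + m_prod mu (inr g) t * (- prod x (inr g) t)
  - m_load mu (busOf (inr g)) t * prod x (inr g) t.

Definition busPart (om : scenario S) (mu : multipliers S) (x : plan)
    (t : period S) (i : bus S) : R :=
  voll S * unmet x i t + m_unmet mu i t * (- unmet x i t)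
  + m_load mu i t * (loadRT om i t - unmet x i t
     - \sum_(j : bus S | (j, i) \in lines S) flow x j i t
     + \sum_(j : bus S | (i, j) \in lines S) flow x i j t).

Definition linePart (mu : multipliers S) (x : plan) (t : period S)
    (ij : bus S * bus S) : R :=
  m_flow mu ij.1 ij.2 t *
    (suscept ij.1 ij.2 * (angle x ij.1 t - angle x ij.2 t) - flow x ij.1 ij.2 t)
  + m_limitup mu ij.1 ij.2 t * (flow x ij.1 ij.2 t - lineCap ij.1 ij.2)
  + m_limitdown mu ij.1 ij.2 t * (- lineCap ij.1 ij.2 - flow x ij.1 ij.2 t).

Definition freeOfRamping (mu : multipliers S) : Prop :=
  forall g t, m_rampup mu g t = 0 /\ m_rampdown mu g t = 0.

(** Without ramping terms nothing links two periods, and within a period the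
    term [m_load * (demand - supply)] charges each generator for its production
    at the price of its bus, so that the units separate as well. *)
Lemma lagrangian_separates y om x mu : freeOfRamping mu ->
  lagrangian y om x mu =
  \sum_t (\sum_g thermalPart y mu x t g + \sum_g windPart om mu x t g
    + \sum_i busPart om mu x t i + \sum_(ij in lines S) linePart mu x t ij).
Proof.
move=> no_ramp; rewrite /lagrangian.
rewrite [X in _ + X = _]big1 ?addr0; last first.
  move=> t _; rewrite big1 // => s _; rewrite big1 // => g _.
  by rewrite (no_ramp g t).2 mul0r.
rewrite [X in _ + X = _]big1 ?addr0; last first.
  move=> t _; rewrite big1 // => s _; rewrite big1 // => g _.
  by rewrite (no_ramp g t).1 mul0r.
rewrite /rtCost -!big_split /=; apply: eq_bigr => t _.
rewrite !big_sumType /=.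
have -> : \sum_g thermalPart y mu x t g =
    \sum_g gcost x g t
    + \sum_g \sum_o m_cost mu o g t *
        (slope o g * prod x (inl g) t + intercept o g * (y g (hourOf t))%:R
         - gcost x g t)
    + \sum_g m_pmin mu g t *
        (Pmin g * (y g (hourOf t))%:R - prod x (inl g) t)
    + \sum_g m_pmax mu g t *
        (prod x (inl g) t - Pmax g * (y g (hourOf t))%:R)
    + \sum_g m_prod mu (inl g) t * (- prod x (inl g) t)
    - \sum_g m_load mu (busOf (inl g)) t * prod x (inl g) t.
  by rewrite -!big_split -sumrB.
have -> : \sum_g windPart om mu x t g =
    \sum_g m_wind mu g t *
        (windRT om g t - (prod x (inr g) t + curtail x g t))
    + \sum_g m_curtail mu g t * (- curtail x g t)
    + \sum_g m_prod mu (inr g) t * (- prod x (inr g) t)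
    - \sum_g m_load mu (busOf (inr g)) t * prod x (inr g) t.
  by rewrite -!big_split -sumrB.
have -> : \sum_(ij in lines S) linePart mu x t ij =
    \sum_(ij in lines S) m_flow mu ij.1 ij.2 t *
      (suscept ij.1 ij.2 * (angle x ij.1 t - angle x ij.2 t)
       - flow x ij.1 ij.2 t)
    + \sum_(ij in lines S) m_limitup mu ij.1 ij.2 t *
      (flow x ij.1 ij.2 t - lineCap ij.1 ij.2)
    + \sum_(ij in lines S) m_limitdown mu ij.1 ij.2 t *
      (- lineCap ij.1 ij.2 - flow x ij.1 ij.2 t).
  by rewrite -!big_split.
have -> : \sum_i m_load mu i t * (loadRT om i t - supply x i t) =
    \sum_i busPart om mu x t i
    - \sum_i voll S * unmet x i t - \sum_i m_unmet mu i t * (- unmet x i t)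
    - (\sum_g m_load mu (busOf (inl g)) t * prod x (inl g) t
       + \sum_g m_load mu (busOf (inr g)) t * prod x (inr g) t).
  rewrite -(big_sumType _ xpredT
    (fun g : gen S => m_load mu (busOf g) t * prod x g t)).
  rewrite (partition_big (@busOf R S) xpredT) //= -!sumrB.
  apply: eq_bigr => i _; rewrite /supply /busPart.
  have -> : \sum_(g : gen S | busOf g == i) m_load mu (busOf g) t * prod x g t =
      m_load mu i t * \sum_(g : gen S | busOf g == i) prod x g t.
    by rewrite mulr_sumr; apply: eq_bigr => g /eqP ->.
  ring.
ring.
Qed.

End Separation.

(** * Exchanging dual solutions of two commitments *)

Section Exchange.
Variables (R : realType) (S : market R).
Local Notation plan := (dispatch S (period S)).

(** The exchange for a unit that is off on the side of [y] ([false]) and on on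
    the side of [ystar] ([true]).  The constants only occur on the [ystar] side
    and are the same before and after.  The rest is linear in [(h, p)] with
    equal coefficients on both sides, since raising [r] by [lam - lam'] makes up
    for the lower price; so the two dispatches can be pooled on the [ystar] side,
    and an idle unit contributes 0 whatever its multipliers [c'], [a'], [b'],
    [r'] are. *)
Lemma thermalTerm_pool (g : ther S) lam lam' c c' a b r a' b' r' h p h' p' :
  thermalTerm g false lam c a b r h p
    + thermalTerm g true lam' c a b (r + (lam - lam')) h' p' =
  thermalTerm g false lam' c' a' b' r' 0 0
    + thermalTerm g true lam c a b r (h + h') (p + p').
Proof.
rewrite /thermalTerm.
have -> : \sum_o c' o * (slope o g * 0 + intercept o g * false%:R - 0) = 0.
  by rewrite big1 // => o _ /=; ring.
have -> : \sum_o c o * (slope o g * (p + p') + intercept o g * true%:R - (h + h'))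
   = \sum_o c o * (slope o g * p + intercept o g * false%:R - h)
   + \sum_o c o * (slope o g * p' + intercept o g * true%:R - h').
  by rewrite -big_split; apply: eq_bigr => o _ /=; ring.
by rewrite /=; ring.
Qed.

Variables (y ystar : commitment S) (om : scenario S).
Variables (mu nu : multipliers S) (A : pred (period S)).

Definition extra (g : ther S) (t : period S) : bool :=
  ystar g (hourOf t) && ~~ y g (hourOf t).

(** New multipliers for [y]: those of [mu] on [A], those of [nu] elsewhere. *)
Definition raised : multipliers S :=
  Multipliers
    (fun i t => if A t then m_load mu i t else m_load nu i t)
    (fun i t => if A t then m_unmet mu i t else m_unmet nu i t)
    (fun o g t => if A t then m_cost mu o g t else m_cost nu o g t)
    (fun g t => if A t then m_pmin mu g t else m_pmin nu g t)
    (fun g t => if A t then m_pmax mu g t else m_pmax nu g t)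
    (fun g t => if A t then m_wind mu g t else m_wind nu g t)
    (fun g t => if A t then m_curtail mu g t else m_curtail nu g t)
    (fun g t => if A t then m_prod mu g t else m_prod nu g t)
    (fun i j t => if A t then m_flow mu i j t else m_flow nu i j t)
    (fun i j t => if A t then m_limitup mu i j t else m_limitup nu i j t)
    (fun i j t => if A t then m_limitdown mu i j t else m_limitdown nu i j t)
    (fun _ _ => 0) (fun _ _ => 0).

(** New multipliers for [ystar]: those of [nu] on [A], those of [mu] elsewhere,
    except that an extra unit keeps [mu] everywhere and compensates for the
    change of price on [A] by the multiplier of [0 <= prod]. *)
Definition lowered : multipliers S :=
  Multipliers
    (fun i t => if A t then m_load nu i t else m_load mu i t)
    (fun i t => if A t then m_unmet nu i t else m_unmet mu i t)
    (fun o g t => if A t && ~~ extra g t then m_cost nu o g t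
                  else m_cost mu o g t)
    (fun g t => if A t && ~~ extra g t then m_pmin nu g t else m_pmin mu g t)
    (fun g t => if A t && ~~ extra g t then m_pmax nu g t else m_pmax mu g t)
    (fun g t => if A t then m_wind nu g t else m_wind mu g t)
    (fun g t => if A t then m_curtail nu g t else m_curtail mu g t)
    (fun g t => if ~~ A t then m_prod mu g t else
       if g is inl th then
         if extra th t then
           m_prod mu g t + (m_load mu (busOf g) t - m_load nu (busOf g) t)
         else m_prod nu g t
       else m_prod nu g t)
    (fun i j t => if A t then m_flow nu i j t else m_flow mu i j t)
    (fun i j t => if A t then m_limitup nu i j t else m_limitup mu i j t)
    (fun i j t => if A t then m_limitdown nu i j t else m_limitdown mu i j t)
    (fun _ _ => 0) (fun _ _ => 0).

(** The dispatches at which the old multipliers reproduce, in total, the value of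
    the new ones at [x] and [x']: the two plans are swapped on [A], and an extra
    unit is idle in the first and runs the sum of both in the second. *)
Definition swapIdle (x x' : plan) : plan :=
  Dispatch
    (fun g t => if ~~ A t then gcost x g t else
       if extra g t then 0 else gcost x' g t)
    (fun g t => if ~~ A t then prod x g t else
       if g is inl th then if extra th t then 0 else prod x' g t
       else prod x' g t)
    (fun i t => if A t then unmet x' i t else unmet x i t)
    (fun g t => if A t then curtail x' g t else curtail x g t)
    (fun i j t => if A t then flow x' i j t else flow x i j t)
    (fun i t => if A t then angle x' i t else angle x i t).

Definition swapPool (x x' : plan) : plan :=
  Dispatch
    (fun g t => if ~~ A t then gcost x' g t else
       if extra g t then gcost x g t + gcost x' g t else gcost x g t)
    (fun g t => if ~~ A t then prod x' g t else
       if g is inl th then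
         if extra th t then prod x g t + prod x' g t else prod x g t
       else prod x g t)
    (fun i t => if A t then unmet x i t else unmet x' i t)
    (fun g t => if A t then curtail x g t else curtail x' g t)
    (fun i j t => if A t then flow x i j t else flow x' i j t)
    (fun i t => if A t then angle x i t else angle x' i t).

Hypothesis mu_ramp : freeOfRamping mu.
Hypothesis nu_ramp : freeOfRamping nu.
Hypothesis y_le : forall t, A t -> forall g, y g (hourOf t) -> ystar g (hourOf t).

Lemma lagrangian_exchange x x' :
  lagrangian y om x raised + lagrangian ystar om x' lowered =
  lagrangian y om (swapIdle x x') nu + lagrangian ystar om (swapPool x x') mu.
Proof.
rewrite !lagrangian_separates // -!big_split; apply: eq_bigr => t _ /=.
have thermal : \sum_g thermalPart y raised x t g
      + \sum_g thermalPart ystar lowered x' t g =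
    \sum_g thermalPart y nu (swapIdle x x') t g
      + \sum_g thermalPart ystar mu (swapPool x x') t g.
  rewrite -!big_split; apply: eq_bigr => g _; rewrite /thermalPart /=.
  have [At|//] := boolP (A t).
  have := y_le At (g := g); rewrite /extra /=.
  case: (y g _); case: (ystar g _) => /= y_le_g.
  - by rewrite addrC.
  - by have := y_le_g isT.
  - exact: thermalTerm_pool.
  - by rewrite addrC.
have windy : \sum_g windPart om raised x t g + \sum_g windPart om lowered x' t g =
    \sum_g windPart om nu (swapIdle x x') t g
      + \sum_g windPart om mu (swapPool x x') t g.
  rewrite -!big_split; apply: eq_bigr => g _; rewrite /windPart /=.
  by case: (A t); rewrite //= addrC.
have buses : \sum_i busPart om raised x t i + \sum_i busPart om lowered x' t i =
    \sum_i busPart om nu (swapIdle x x') t i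
      + \sum_i busPart om mu (swapPool x x') t i.
  rewrite -!big_split; apply: eq_bigr => i _; rewrite /busPart /=.
  by case: (A t); rewrite //= addrC.
have lined : \sum_(ij in lines S) linePart raised x t ij
      + \sum_(ij in lines S) linePart lowered x' t ij =
    \sum_(ij in lines S) linePart nu (swapIdle x x') t ij
      + \sum_(ij in lines S) linePart mu (swapPool x x') t ij.
  rewrite -!big_split; apply: eq_bigr => ij _; rewrite /linePart /=.
  by case: (A t); rewrite //= addrC.
lra.
Qed.

Hypothesis price_le : forall t, A t -> forall i, m_load nu i t <= m_load mu i t.

(** For arbitrary dispatches [x] and [x'], the exchange identity bounds
    [lagrangian y x raised + lagrangian ystar x' lowered] below by the sum
    [v + vstar] of the optimal dual values.  Freezing [x], the number
    [v + vstar - lagrangian y x raised] is thus a dual value for [ystar], hence at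
    most [vstar], which says that [raised] attains [v]. *)
Lemma raised_dualOptimal :
  dualOptimal ystar om mu -> dualOptimal y om nu -> dualOptimal y om raised.
Proof.
move=> [vstar [[mu_sign mu_le] vstar_max]] [v [[nu_sign nu_le] v_max]].
have [? ? ? ? ? ? ? ? ? ?] := mu_sign; have [? ? ? ? ? ? ? ? ? ?] := nu_sign.
have lowered_sign : dualSigns lowered.
  split=> //=; try by move=> *; case: ifP.
  move=> [g|g] t; have [At|_] //= := boolP (A t).
  by case: ifP => // _; rewrite addr_ge0 // subr_ge0 price_le.
exists v; split=> //; split; first by split=> //= *; case: ifP.
move=> x; suff : v + vstar - lagrangian y om x raised <= vstar by lra.
apply: (vstar_max lowered); split=> // x'.
have := lagrangian_exchange x x'.
have := nu_le (swapIdle x x'); have := mu_le (swapPool x x').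
lra.
Qed.

End Exchange.

(** * Exposures *)

Section Exposure.
Variables (R : realType) (S : market R).
Implicit Types (y : commitment S) (om : scenario S).
Implicit Types (lam : bus S -> period S -> R).

Definition unmetPlan (u : bus S -> period S -> R) : dispatch S (period S) :=
  Dispatch (fun _ _ => 0) (fun _ _ => 0) u (fun _ _ => 0)
    (fun _ _ _ => 0) (fun _ _ => 0).

Lemma lagrangian_unmet y om mu (u : bus S -> period S -> R) :
  lagrangian y om (unmetPlan u) mu = lagrangian y om (zeroPlan S) mu
    + \sum_t \sum_i (voll S - m_load mu i t - m_unmet mu i t) * u i t.
Proof.
rewrite /lagrangian /=.
have -> : rtCost (unmetPlan u) = rtCost (zeroPlan S)
    + \sum_t \sum_i voll S * u i t.
  rewrite /rtCost -big_split /=; apply: eq_bigr => t _.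
  rewrite [X in _ = _ + X + _]big1 ?addr0 // => i _; exact: mulr0.
have -> : \sum_(t : period S) \sum_i
      m_load mu i t * (loadRT om i t - supply (unmetPlan u) i t) =
    \sum_(t : period S) \sum_i
      m_load mu i t * (loadRT om i t - supply (zeroPlan S) i t)
    - \sum_t \sum_i m_load mu i t * u i t.
  rewrite -sumrB; apply: eq_bigr => t _; rewrite -sumrB.
  by apply: eq_bigr => i _; rewrite /supply /=; ring.
have -> : \sum_(t : period S) \sum_i m_unmet mu i t * - u i t =
    \sum_(t : period S) \sum_i m_unmet mu i t * - 0
    - \sum_t \sum_i m_unmet mu i t * u i t.
  rewrite -sumrB; apply: eq_bigr => t _; rewrite -sumrB.
  by apply: eq_bigr => i _; ring.
have -> : \sum_t \sum_i (voll S - m_load mu i t - m_unmet mu i t) * u i t =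
    \sum_t \sum_i voll S * u i t - \sum_t \sum_i m_load mu i t * u i t
    - \sum_t \sum_i m_unmet mu i t * u i t.
  rewrite -!sumrB; apply: eq_bigr => t _; rewrite -!sumrB.
  by apply: eq_bigr => i _; ring.
ring.
Qed.

(** Unmet load enters the lagrangian with coefficient
    [voll - lam - m_unmet], and a dual feasible lagrangian is bounded below, so
    this coefficient vanishes; ruling out a negative value suffices. *)
Lemma price_le_voll y om lam i t : isLMP y om lam -> lam i t <= voll S.
Proof.
move=> [mu [[v [[[unmet_ge0 _ _ _ _ _ _ _ _ _] v_le] _]] <-]].
set c := voll S - m_load mu i t - m_unmet mu i t.
suff : 0 <= c by have := unmet_ge0 i t; rewrite /c; lra.
rewrite leNgt; apply/negP => c_lt0.
pose L0 := lagrangian y om (zeroPlan S) mu.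
(* This amount of unmet load brings the lagrangian down to v - 1. *)
pose a := (v - L0 - 1) / c.
have := v_le (unmetPlan (fun j s => if (j == i) && (s == t) then a else 0)).
rewrite lagrangian_unmet -/L0.
rewrite (bigD1 t) //= [X in _ + (_ + X)]big1 ?addr0; last first.
  move=> s /negPf st; rewrite big1 // => j _.
  by rewrite st andbF mulr0.
rewrite (bigD1 i) //= [X in _ + (_ + X)]big1 ?addr0; last first.
  by move=> j /negPf ji; rewrite ji mulr0.
rewrite !eqxx /= -/c /a mulrC divfK ?lt_eqF //.
by lra.
Qed.

Lemma loadExcess_ge0 om i t : 0 <= loadExcess om i t.
Proof. by rewrite /loadExcess le_max lexx orbT. Qed.

Lemma loadExcess_bound om i t : Omega om ->
  loadExcess om i t <= \sum_k `|Qd k i t| * absBoundD S.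
Proof.
move=> [alphad [alphaw [[load_eq _ _ _] [_ alphad_le _ _]]]].
have bound_ge0 : 0 <= \sum_k `|Qd k i t| * absBoundD S.
  apply: sumr_ge0 => k _; rewrite mulr_ge0 //.
  exact: le_trans (normr_ge0 _) (alphad_le k t).
rewrite /loadExcess ge_max bound_ge0 andbT load_eq addrAC subrr add0r.
apply: ler_sum => k _; apply: le_trans (ler_norm _) _.
by rewrite normrM ler_wpM2l.
Qed.

Lemma Ntp_inv_ge0 : 0 <= (Ntp S)^-1.
Proof. by rewrite invr_ge0 divr_ge0 ?ler0n. Qed.

(** The point is that the exposures are bounded above: otherwise the supremum
    would be the default value 0. *)
Lemma exposure_le_Vhat y om lam :
  Omega om -> isLMP y om lam -> exposure om lam <= Vhat y.
Proof.
move=> om_Omega lam_LMP; apply: ub_le_sup; last by exists om, lam.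
exists ((Ntp S)^-1 * \sum_t \sum_i
  `|voll S| * \sum_k `|@Qd R S k i t| * absBoundD S).
move=> _ [om1 [lam1 [om1_Omega lam1_LMP ->]]].
rewrite ler_wpM2l ?Ntp_inv_ge0 //; apply: ler_sum => t _; apply: ler_sum => i _.
apply: (@le_trans _ _ (`|voll S| * loadExcess om1 i t)).
  rewrite ler_wpM2r ?loadExcess_ge0 //.
  exact: le_trans (price_le_voll i t lam1_LMP) (ler_norm _).
by rewrite ler_wpM2l // loadExcess_bound.
Qed.

Lemma exposure_by_hour om lam :
  exposure om lam = \sum_(h in rtHours S) hourExposure om lam h.
Proof.
rewrite /exposure /hourExposure -mulr_sumr; congr (_ * _).
by apply: partition_big => t _; apply: imset_f.
Qed.

Lemma hourExposure_ge0 om lam h :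
  (forall i t, 0 <= lam i t * loadExcess om i t) -> 0 <= hourExposure om lam h.
Proof.
move=> pay_ge0; rewrite mulr_ge0 ?Ntp_inv_ge0 //.
by apply: sumr_ge0 => t _; apply: sumr_ge0.
Qed.

Lemma ler_hourExposure om lam lam' h :
    (forall i t, hourOf t = h -> lam i t <= lam' i t) ->
  hourExposure om lam h <= hourExposure om lam' h.
Proof.
move=> lam_le; rewrite ler_wpM2l ?Ntp_inv_ge0 //.
apply: ler_sum => t /eqP th; apply: ler_sum => i _.
by rewrite ler_wpM2r ?loadExcess_ge0 ?lam_le.
Qed.

(** * Prices under fewer commitments *)

(** The exchange is made at all periods where the units of [y] run in [ystar] and
    [nu] has the lower prices.  At the remaining periods of the first kind some
    bus has the higher price under [nu], hence all buses do, as prices are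
    uniform. *)
Lemma exists_higher_LMP y ystar om lamstar :
    realTimeSolvable S -> noCongestion S -> rampingNotBinding S ->
    feasible y -> feasible ystar -> Omega om -> isLMP ystar om lamstar ->
  exists lam, isLMP y om lam /\ forall t,
    (forall g, y g (hourOf t) -> ystar g (hourOf t)) ->
    forall i, lamstar i t <= lam i t.
Proof.
move=> solvable uncongested ramp_slack y_feas ystar_feas om_Omega.
move=> lamstar_LMP; have lamstar_uniform :=
  (uncongested _ _ ystar_feas om_Omega).2 _ lamstar_LMP.
move: lamstar_LMP => [mu0 [mu0_opt mu0E]].
have [mu [mu_opt muE mu_ramp]] := ramp_slack _ _ ystar_feas om_Omega _ mu0_opt.
have [x x_opt] := solvable _ _ y_feas om_Omega.
have [nu0 nu0_opt] := dualOptimal_exists x_opt.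
have [nu [nu_opt _ nu_ramp]] := ramp_slack _ _ y_feas om_Omega _ nu0_opt.
have nu_uniform := (uncongested _ _ y_feas om_Omega).2 _
  (ex_intro _ nu (conj nu_opt erefl)).
rewrite -{}mu0E -{mu0 mu0_opt}muE in lamstar_uniform *.
pose A t := [forall g, y g (hourOf t) ==> ystar g (hourOf t)] &&
  [forall i, m_load nu i t <= m_load mu i t].
exists (m_load (raised mu nu A)); split.
  exists (raised mu nu A); split=> //.
  apply: (raised_dualOptimal (ystar := ystar)) => //.
  - by move=> t /andP[/forallP sub _] g; apply/implyP/sub.
  - by move=> t /andP[_ /forallP].
move=> t sub i /=; case: ifPn => // /nandP[] /forallPn[].
  by move=> g /negP[]; apply/implyP/sub.
move=> j; rewrite -ltNge (lamstar_uniform j i) (nu_uniform j i).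
exact: ltW.
Qed.

End Exposure.
Unset Implicit Arguments.

(** * The cut *)

Theorem mainTheorem1 (R : realType) (S : market R)
  (solvable : realTimeSolvable S)
  (payment_ge0 : exposureNonneg S)
  (uncongested : noCongestion S)
  (ramp_slack : rampingNotBinding S)
  (ystar : commitment S) (omstar : scenario S)
  (lamstar : bus S -> period S -> R)
  (ystar_feasible : feasible ystar)
  (omstar_Omega : Omega omstar)
  (lamstar_LMP : isLMP ystar omstar lamstar)
  (worst_case : exposure omstar lamstar = Vhat ystar) :
  (forall y : commitment S, feasible y ->
     cut ystar omstar lamstar y <= Vhat y) /\
  cut ystar omstar lamstar ystar = Vhat ystar.
Proof.
split=> [y y_feasible|]; last first.
  (* No unit is both off and on in ystar, so every factor is 1. *)
  rewrite -worst_case exposure_by_hour; apply: eq_bigr => h _.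
  by rewrite big1 ?subr0 ?mulr1 // => g /negPf ->.
have [lam [lam_LMP lam_ge]] := exists_higher_LMP solvable uncongested
  ramp_slack y_feasible ystar_feasible omstar_Omega lamstar_LMP.
apply: le_trans (exposure_le_Vhat omstar_Omega lam_LMP).
rewrite exposure_by_hour; apply: ler_sum => h _.
have [/existsP[g /andP[ystar_g y_g]]|] :=
  boolP [exists g, ~~ ystar g h && y g h].
  apply: (@le_trans _ _ 0); last first.
    exact/hourExposure_ge0/(payment_ge0 _ _ y_feasible omstar_Omega).
  rewrite mulr_ge0_le0 //.
    exact/hourExposure_ge0/(payment_ge0 _ _ ystar_feasible omstar_Omega).
  rewrite (bigD1 g) //= y_g opprD addrA subrr sub0r oppr_le0.
  exact: sumr_ge0.
move=> /existsPn no_extra.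
have sub g : y g h -> ystar g h.
  by move=> y_g; have := no_extra g; rewrite y_g andbT negbK.
rewrite big1 ?subr0 ?mulr1; last first.
  by move=> g /negP ystar_g; case: (boolP (y g h)) => // /sub.
apply: ler_hourExposure => i t th; apply: lam_ge => g.
by rewrite th; apply: sub.
Qed.
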